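(* Let $\alpha\neq0$ and $\lambda\in\mathbb{R}$. Along every solution $g_t$ of the evolution equation $g''=\Gamma^-_g(g',g')-2\alpha\operatorname{grad}^-S_\lambda(g)$, with $k:=g'$, the energy density $\mathcal{H}_\lambda(g,k)=\tfrac12\langle k,k\rangle^-_g+2\alpha\tau_\lambda(g)$ satisfies $$\partial_t\,\mathcal{H}_\lambda(g,k)=-\tfrac12\,\operatorname{tr}_g(k)\,\mathcal{H}_\lambda(g,k)+2\alpha\,\delta_g\bigl(\delta^{-}_{g}k\bigr),$$ equivalently, since $\partial_t\mu_g=\tfrac12\operatorname{tr}_g(k)\,\mu_g$, $$\partial_t\Bigl(\mathcal{H}_\lambda(g,k)\,\mu_{g}\Bigr)=2\alpha\,\delta_g\bigl(\delta^{-}_{g}k\bigr)\,\mu_{g}.$$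
   Context: $M$ is a compact connected smooth manifold without boundary, $\dim M=n\ge2$. $S^2(M)$ is the Fréchet space of smooth symmetric $(0,2)$-tensor fields on $M$, and $\mathcal{M}\subset S^2(M)$ is the open cone of Riemannian metrics. A solution $g_t$, $t\in I$ ($I$ an open interval), is a smooth curve in $\mathcal{M}$; primes denote $t$-derivatives. For $g\in\mathcal{M}$: $\rho(g)$ is the Ricci tensor, $\tau(g)=\operatorname{tr}_g\rho(g)$ the scalar curvature, $\mu_g$ the volume density, $\operatorname{tr}_gh=\operatorname{tr}(g^{-1}h)$, $(\delta_gh)_j=-g^{ik}\nabla_ih_{kj}$ for $h\in S^2(M)$, $\delta_g\omega=-g^{ij}\nabla_i\omega_j$ for one-forms, and $$\langle h,k\rangle^-_g=\operatorname{tr}(g^{-1}hg^{-1}k)-\operatorname{tr}_g(h)\operatorname{tr}_g(k),\qquad G^-_g(h,k)=\int_M\langle h,k\rangle^-_g\,\mu_g,\qquad \delta^-_gh=\delta_gh+d(\operatorname{tr}_gh).$$ $\Gamma^-_g(h,h)=hg^{-1}h-\tfrac12\operatorname{tr}_g(h)h-\tfrac{1}{4(n-1)}\langle h,h\rangle^-_g\,g$ is the Christoffel map of $G^-$. Further, $\tau_\lambda(g)=\tau(g)-\lambda(n-1)$, $S_\lambda(g)=\int_M\tau_\lambda(g)\mu_g$, with $G^-$-gradient $\operatorname{grad}^-S_\lambda(g)=-\rho(g)+\frac{1}{2(n-1)}\tau(g)g+\frac{\lambda}{2}g$. *)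

(* Defs.v *)
From HB Require Import structures.
From mathcomp Require Import all_boot all_order all_algebra.
From mathcomp Require Import all_classical all_reals all_analysis.
Set Implicit Arguments.
Unset Strict Implicit.
Unset Printing Implicit Defensive.
Import Order.TTheory GRing.Theory Num.Theory.
Import numFieldNormedType.Exports.
Local Open Scope classical_set_scope.
Local Open Scope ring_scope.

Definition partial (R : realType) (n : nat) (i : 'I_n) (f : 'rV[R]_n -> R) :
  'rV[R]_n -> R := fun x => 'D_(delta_mx 0 i) f x.

Definition iter_partial (R : realType) (n : nat) (s : seq 'I_n)
  (f : 'rV[R]_n -> R) : 'rV[R]_n -> R := foldr (@partial R n) f s.

(* C^oo on V (used for open V only): all iterated partial derivatives exist
   and are (Frechet) differentiable at every point of V. *)
Definition smooth_on (R : realType) (n : nat) (V : set 'rV[R]_n)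
    (f : 'rV[R]_n -> R) : Prop :=
  forall (s : seq 'I_n) (x : 'rV[R]_n), V x -> differentiable (iter_partial s f) x.

(* A smooth manifold given by an atlas indexed by [chart].  The chart [c] is the
   homeomorphism [chart_map c] from the open set [chart_dom c] onto the open set
   [chart_img c] of R^n, with inverse [chart_inv c]; values outside of these sets are
   irrelevant. *)
Record manifold (R : realType) (n : nat) := Manifold {
  space :> topologicalType ;
  space_hausdorff : hausdorff_space space ;
  space_second_countable : @second_countable space ;
  chart : Type ;
  chart_dom : chart -> set space ;
  chart_img : chart -> set 'rV[R]_n ;
  chart_map : chart -> space -> 'rV[R]_n ;
  chart_inv : chart -> 'rV[R]_n -> space ;
  chart_dom_open : forall c, open (chart_dom c) ;
  chart_img_open : forall c, open (chart_img c) ;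
  chart_dom_cover : forall p, exists c, chart_dom c p ;
  map_in_img : forall c p, chart_dom c p -> chart_img c (chart_map c p) ;
  inv_in_dom : forall c x, chart_img c x -> chart_dom c (chart_inv c x) ;
  chart_mapK : forall c p, chart_dom c p -> chart_inv c (chart_map c p) = p ;
  chart_invK : forall c x, chart_img c x -> chart_map c (chart_inv c x) = x ;
  chart_map_continuous : forall c p, chart_dom c p -> {for p, continuous (chart_map c)} ;
  chart_inv_continuous : forall c x, chart_img c x -> {for x, continuous (chart_inv c)} ;
  transition_smooth : forall c d (j : 'I_n),
    smooth_on [set x | chart_img c x /\ chart_dom d (chart_inv c x)]
              (fun x => chart_map d (chart_inv c x) 0 j) }.

(* Components, in a chart, of a (0,2)-tensor and of a one-form. *)
Definition lfield (R : realType) (n : nat) := 'rV[R]_n -> 'M[R]_n.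
Definition lform (R : realType) (n : nat) := 'rV[R]_n -> 'rV[R]_n.

(* A (0,2)-tensor field as the family of its components in the charts. *)
Definition tfield (R : realType) (n : nat) (M : manifold R n) :=
  chart M -> lfield R n.

(* [h] belongs to S^2(M).  Since ('J f x) i a = d_i f_a, the last clause is
   h^c_ij = (d_i y^a) (d_j y^b) h^d_ab for the change of coordinates y(x). *)
Definition is_sym_tensor (R : realType) (n : nat) (M : manifold R n)
    (h : tfield M) : Prop :=
  [/\ forall c i j, smooth_on (chart_img c) (fun x => h c x i j),
      forall c x, chart_img c x -> (h c x)^T = h c x &
      forall (c d : chart M) x, chart_img c x -> chart_dom d (chart_inv c x) ->
        let J := 'J (fun y => chart_map d (chart_inv c y)) x in
        h c x = J *m h d (chart_map d (chart_inv c x)) *m J^T].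

Definition is_metric (R : realType) (n : nat) (M : manifold R n)
    (g : tfield M) : Prop :=
  is_sym_tensor g /\
  forall c x, chart_img c x ->
    forall v : 'rV[R]_n, v != 0 -> 0 < (v *m g c x *m v^T) 0 0.

(* Convergence in the Frechet space S^2(M): in every chart, each iterated
   partial derivative of each component converges uniformly on compacta. *)
Definition tensor_cvg (R : realType) (n : nat) (M : manifold R n)
    (F : set_system R) (u : R -> tfield M) (l : tfield M) : Prop :=
  forall (c : chart M) (K : set 'rV[R]_n) (s : seq 'I_n) (i j : 'I_n),
    compact K -> K `<=` chart_img c ->
    {uniform K, (fun e => iter_partial s (fun x => u e c x i j)) @ F -->
                iter_partial s (fun x => l c x i j)}.

Definition tderiv (R : realType) (n : nat) (M : manifold R n)
    (g : R -> tfield M) : R -> tfield M :=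
  fun t c x => \matrix_(i, j) (derive1 (fun s => g s c x i j) t : R).

(* Smooth curve in the Frechet space S^2(M): derivatives of all orders exist as
   limits of difference quotients in S^2(M).  Such a limit is necessarily the
   pointwise [tderiv]. *)
Definition smooth_curve (R : realType) (n : nat) (M : manifold R n)
    (I : set R) (g : R -> tfield M) : Prop :=
  forall (m : nat) (t : R), I t ->
    let u := iter m (@tderiv R n M) g in
    is_sym_tensor (u t) /\
    tensor_cvg 0^' (fun e c x => e^-1 *: (u (t + e) c x - u t c x))
                   (tderiv u t).

Definition smooth_metric_curve (R : realType) (n : nat) (M : manifold R n)
    (I : set R) (g : R -> tfield M) : Prop :=
  smooth_curve I g /\ forall t, I t -> is_metric (g t).

(* Christoffel symbols of the second kind: [christoffel g k i j] is
   Gamma^k_ij of the Levi-Civita connection. *)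
Definition christoffel (R : realType) (n : nat) (g : lfield R n)
    (k i j : 'I_n) : 'rV[R]_n -> R := fun x =>
  2^-1 * \sum_l invmx (g x) k l *
    (partial i (fun y => g y j l) x + partial j (fun y => g y i l) x
     - partial l (fun y => g y i j) x).

(* [riemann g l k i j] is R^l_kij, where R(d_i, d_j) d_k = R^l_kij d_l and
   R(X, Y) = [nabla_X, nabla_Y] - nabla_[X, Y]. *)
Definition riemann (R : realType) (n : nat) (g : lfield R n)
    (l k i j : 'I_n) : 'rV[R]_n -> R := fun x =>
  partial i (christoffel g l j k) x - partial j (christoffel g l i k) x
  + \sum_m (christoffel g l i m x * christoffel g m j k x
            - christoffel g l j m x * christoffel g m i k x).

(* With this sign convention, the round sphere has positive Ricci tensor. *)
Definition ricci (R : realType) (n : nat) (g : lfield R n) : lfield R n :=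
  fun x => \matrix_(j, k) \sum_i riemann g i k i j x.

Definition trg (R : realType) (n : nat) (g h : lfield R n) : 'rV[R]_n -> R :=
  fun x => \tr (invmx (g x) *m h x).

Definition scal (R : realType) (n : nat) (g : lfield R n) : 'rV[R]_n -> R :=
  trg g (ricci g).

(* Density of the volume mu_g with respect to |dx^1 ... dx^n|. *)
Definition vol (R : realType) (n : nat) (g : lfield R n) : 'rV[R]_n -> R :=
  fun x => Num.sqrt (\det (g x)).

(* nabla_i h_kj *)
Definition nabla2 (R : realType) (n : nat) (g h : lfield R n)
    (i k j : 'I_n) : 'rV[R]_n -> R := fun x =>
  partial i (fun y => h y k j) x
  - \sum_m (christoffel g m i k x * h x m j + christoffel g m i j x * h x k m).

(* nabla_i w_j *)
Definition nabla1 (R : realType) (n : nat) (g : lfield R n) (w : lform R n)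
    (i j : 'I_n) : 'rV[R]_n -> R := fun x =>
  partial i (fun y => w y 0 j) x - \sum_m christoffel g m i j x * w x 0 m.

Definition delta2 (R : realType) (n : nat) (g h : lfield R n) : lform R n :=
  fun x => \row_j - \sum_i \sum_k invmx (g x) i k * nabla2 g h i k j x.

Definition delta1 (R : realType) (n : nat) (g : lfield R n) (w : lform R n) :
  'rV[R]_n -> R :=
  fun x => - \sum_i \sum_j invmx (g x) i j * nabla1 g w i j x.

Definition ext_d (R : realType) (n : nat) (f : 'rV[R]_n -> R) : lform R n :=
  fun x => \row_j partial j f x.

(* <h, k>^-_g *)
Definition innerm (R : realType) (n : nat) (g h k : lfield R n) :
  'rV[R]_n -> R := fun x =>
  \tr (invmx (g x) *m h x *m invmx (g x) *m k x) - trg g h x * trg g k x.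

(* delta^-_g h *)
Definition deltam (R : realType) (n : nat) (g h : lfield R n) : lform R n :=
  fun x => delta2 g h x + ext_d (trg g h) x.

(* Gamma^-_g(h, h) *)
Definition Gammam (R : realType) (n : nat) (g h : lfield R n) : lfield R n :=
  fun x => h x *m invmx (g x) *m h x - (2^-1 * trg g h x) *: h x
           - ((4 * (n%:R - 1))^-1 * innerm g h h x) *: g x.

Definition scal_lambda (R : realType) (n : nat) (lambda : R) (g : lfield R n) :
  'rV[R]_n -> R := fun x => scal g x - lambda * (n%:R - 1).

(* The G^- -gradient of S_lambda(g) = int_M scal_lambda(g) mu_g. *)
Definition gradm_S (R : realType) (n : nat) (lambda : R) (g : lfield R n) :
  lfield R n := fun x =>
  - ricci g x + ((2 * (n%:R - 1))^-1 * scal g x) *: g x + (lambda / 2) *: g x.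

(* H_lambda(g, k) *)
Definition energy (R : realType) (n : nat) (alpha lambda : R)
    (g k : lfield R n) : 'rV[R]_n -> R := fun x =>
  2^-1 * innerm g k k x + 2 * alpha * scal_lambda lambda g x.

(* g'' = Gamma^-_g(g', g') - 2 alpha grad^- S_lambda(g) on M, for t in I *)
Definition evolution_eq (R : realType) (n : nat) (M : manifold R n)
    (alpha lambda : R) (I : set R) (g : R -> tfield M) : Prop :=
  forall (t : R) (c : chart M) (x : 'rV[R]_n), I t -> chart_img c x ->
    tderiv (tderiv g) t c x =
      Gammam (g t c) (tderiv g t c) x
      - (2 * alpha) *: gradm_S lambda (g t c) x.

(* Main.v *)
(* Everything is local in a chart.  Convergence in S^2(M) says that d/dt commutes with
   all iterated partial derivatives in space.  Writing A^i_jk for the variation of the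
   connection in the direction k = g', this gives Palatini's identity
   Ric'_jk = nabla_i A^i_jk - nabla_j A^i_ik without any appeal to the symmetry of second
   partial derivatives.  Since nabla g = 0, its trace is the codifferential of the
   one-form A^i_il - g_li g^jk A^i_jk, which is delta^- k, so that
   tau' = - <Ric, k> + delta (delta^- k).  The evolution equation gives the derivative of
   <k, k>^-: the cubic terms tr (g^-1 k)^3 of Gamma^- cancel those coming from the
   derivative of g^-1, and the Ricci term of grad^- S cancels - <Ric, k>. *)
Require Import Defs.
From mathcomp Require Import all_boot all_order all_algebra.
From mathcomp Require Import all_classical all_reals all_analysis.
From mathcomp Require Import perm ring lra.
Set Implicit Arguments.
Unset Strict Implicit.
Unset Printing Implicit Defensive.
Import Order.TTheory GRing.Theory Num.Theory.
Import numFieldNormedType.Exports.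
Local Open Scope classical_set_scope.
Local Open Scope ring_scope.

(** * Derivatives *)

Section DirectionalDerivatives.
Variables (R : realType) (V : normedModType R).
Implicit Types (f g : V -> R) (x v : V).

Lemma is_derive_derivable f x v (df : R) :
  is_derive x v f df -> derivable f x v.
Proof. by case. Qed.

Lemma is_derive_add f g x v (df dg : R) :
  is_derive x v f df -> is_derive x v g dg ->
  is_derive x v (fun y => f y + g y) (df + dg).
Proof. by move=> hf hg; exact: is_deriveD. Qed.

Lemma is_derive_opp f x v (df : R) :
  is_derive x v f df -> is_derive x v (fun y => - f y) (- df).
Proof. by move=> hf; exact: is_deriveN. Qed.

Lemma is_derive_sub f g x v (df dg : R) :
  is_derive x v f df -> is_derive x v g dg ->
  is_derive x v (fun y => f y - g y) (df - dg).
Proof. by move=> hf hg; exact: is_deriveB. Qed.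

Lemma is_derive_mul f g x v (df dg : R) :
  is_derive x v f df -> is_derive x v g dg ->
  is_derive x v (fun y => f y * g y) (df * g x + f x * dg).
Proof.
move=> hf hg; have h := is_deriveM hf hg.
by apply: is_derive_eq h _; rewrite addrC; congr (_ + _); exact: mulrC.
Qed.

Lemma is_derive_const (a : R) x v : is_derive x v (fun=> a) 0.
Proof. exact: is_derive_cst. Qed.

Lemma is_derive_scale (a : R) f x v (df : R) :
  is_derive x v f df -> is_derive x v (fun y => a * f y) (a * df).
Proof.
move=> hf; apply: is_derive_eq (is_derive_mul (is_derive_const a x v) hf) _.
by rewrite mul0r add0r.
Qed.

Lemma is_derive_inv f x v (df : R) : f x != 0 ->
  is_derive x v f df -> is_derive x v (fun y => (f y)^-1) (- (f x) ^- 2 * df).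
Proof.
by move=> fx0 [hf <-]; apply: DeriveDef; [exact: derivableV|exact: deriveV].
Qed.

Lemma is_derive_bigsum (J : Type) (r : seq J) (P : pred J) (f : J -> V -> R)
    (df : J -> R) x v :
  (forall j, is_derive x v (f j) (df j)) ->
  is_derive x v (fun y => \sum_(j <- r | P j) f j y) (\sum_(j <- r | P j) df j).
Proof.
move=> hf; elim: r => [|j r IH].
  rewrite big_nil; under eq_fun do rewrite big_nil; exact: is_derive_const.
rewrite big_cons; under eq_fun do rewrite big_cons.
by case: (P j) => //; exact: is_derive_add.
Qed.

Lemma is_derive_prod (J : finType) (f : J -> V -> R) (df : J -> R) x v :
  (forall j, is_derive x v (f j) (df j)) ->
  is_derive x v (fun y => \prod_j f j y)
    (\sum_i df i * \prod_(j | j != i) f j x).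
Proof.
move=> hf.
(* The induction runs over duplicate-free lists, so that the condition [j != i] drops exactly one
   factor. *)
have H (r : seq J) : uniq r -> is_derive x v (fun y => \prod_(j <- r) f j y)
    (\sum_(i <- r) df i * \prod_(j <- r | j != i) f j x).
  elim: r => [_|a r IH /= /andP[ar ur]].
    rewrite big_nil; under eq_fun do rewrite big_nil; exact: is_derive_const.
  under eq_fun do rewrite big_cons.
  apply: is_derive_eq (is_derive_mul (hf a) (IH ur)) _.
  rewrite big_cons; congr (_ + _).
    congr (_ * _); rewrite big_cons eqxx /= big_seq [RHS]big_seq_cond.
    by apply: eq_bigl => j; case: eqP => [->|]; rewrite ?andbT ?(negbTE ar) ?andbF.
  rewrite big_distrr /= big_seq [RHS]big_seq; apply: eq_bigr => i ir.
  rewrite big_cons ifT; last by apply: contraNneq ar => ->.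
  by rewrite mulrCA.
by apply: is_derive_eq (H _ (index_enum_uniq J)) _.
Qed.

End DirectionalDerivatives.

(** * Entrywise derivatives of matrix-valued functions *)

Section DerivativeOfMatrices.
Variables (R : realType) (V : normedModType R) (x v : V).

Definition mx_is_derive (p q : nat) (F : V -> 'M[R]_(p, q)) (dF : 'M[R]_(p, q)) :=
  forall i j, is_derive x v (fun y => F y i j) (dF i j).

Lemma mx_is_derive_mul p q r (F : V -> 'M[R]_(p, q)) (G : V -> 'M[R]_(q, r)) dF dG :
  mx_is_derive F dF -> mx_is_derive G dG ->
  mx_is_derive (fun y => F y *m G y) (dF *m G x + F x *m dG).
Proof.
move=> hF hG i j; rewrite !mxE -big_split /=.
under eq_fun do rewrite mxE.
by apply: is_derive_bigsum => k; exact: is_derive_mul.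
Qed.

Lemma is_derive_trace p (F : V -> 'M[R]_p) dF :
  mx_is_derive F dF -> is_derive x v (fun y => \tr (F y)) (\tr dF).
Proof. by move=> hF; apply: is_derive_bigsum => i; exact: hF. Qed.

(* Jacobi's formula: the term of the product rule which differentiates the [i]-th
   factors of the Leibniz expansion is the determinant of [F x] with [i]-th row
   replaced by that of [dF]. *)
Lemma is_derive_det p (F : V -> 'M[R]_p) dF :
  mx_is_derive F dF ->
  is_derive x v (fun y => \det (F y)) (\tr (\adj (F x) *m dF)).
Proof.
move=> hF.
have H (s : 'S_p) : is_derive x v
    (fun y => (-1) ^+ s * \prod_i F y i (s i))
    ((-1) ^+ s * \sum_i dF i (s i) * \prod_(j | j != i) F x j (s j)).
  by apply/is_derive_scale/is_derive_prod => i; exact: hF.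
apply: is_derive_eq (is_derive_bigsum _ _ H) _.
under eq_bigr do rewrite big_distrr /=.
rewrite exchange_big /= mxtrace_mulC; apply: eq_bigr => i _; rewrite !mxE.
pose B := \matrix_(a, b) (if a == i then dF a b else F x a b).
transitivity (\det B).
  apply: eq_bigr => s _; congr (_ * _).
  rewrite [RHS](bigD1 i) //= mxE eqxx; congr (_ * _).
  by apply: eq_bigr => j /negbTE ji; rewrite mxE ji.
rewrite (expand_det_row B i); apply: eq_bigr => j _; rewrite !mxE eqxx.
congr (_ * (_ * \det _)); apply/matrixP => a b; rewrite !mxE.
by rewrite eq_sym (negbTE (neq_lift _ _)).
Qed.

End DerivativeOfMatrices.

(** Identities between the fields hold only at times in [I] and points of the chart image; as both
    sets are open, this suffices to transfer a derivative. *)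
Lemma is_derive_congr_open (R : realType) (W : normedModType R) (D : set W)
    (f g : W -> R) (x v : W) (df : R) :
  open D -> D x -> {in D, f =1 g} -> is_derive x v f df -> is_derive x v g df.
Proof.
move=> oD Dx fg; apply: near_eq_is_derive.
have := open_nbhs_nbhs (conj oD Dx); apply: filterS => y Dy.
by apply: fg; rewrite inE.
Qed.

(** Cramer's formula shows that the inverse has a derivative; differentiating
    [invmx (F y) *m F y = 1%:M] then determines it. *)
Lemma mx_is_derive_inv (R : realType) (W : normedModType R) (D : set W) (x v : W)
    (p : nat) (F : W -> 'M[R]_p) (dF : 'M[R]_p) :
  open D -> D x -> (forall y, D y -> F y \in unitmx) ->
  mx_is_derive x v F dF ->
  mx_is_derive x v (fun y => invmx (F y)) (- (invmx (F x) *m dF *m invmx (F x))).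
Proof.
move=> oD Dx uF hF.
have d0 y : D y -> \det (F y) != 0 by move=> /uF; rewrite unitmxE unitfE.
have dW i j : is_derive x v (fun y => invmx (F y) i j)
    ('D_v (fun y => invmx (F y) i j) x).
  apply: derivableP.
  have hC : mx_is_derive x v (fun y => row' j (col' i (F y))) (row' j (col' i dF)).
    move=> a b; rewrite !mxE; under eq_fun do rewrite !mxE; exact: hF.
  have T := is_derive_mul
    (is_derive_inv (f := fun y => \det (F y)) (d0 _ Dx) (is_derive_det hF))
    (is_derive_scale ((-1) ^+ (j + i)) (is_derive_det hC)).
  (* [invmx] is the adjugate over the determinant only at invertible matrices, so the formula is
     transferred from [D]. *)
  refine (is_derive_derivable (is_derive_congr_open oD Dx _ T)).
  by move=> y /set_mem Dy; rewrite /invmx uF // !mxE.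
pose dM := \matrix_(i, j) 'D_v (fun y => invmx (F y) i j) x.
have hW : mx_is_derive x v (fun y => invmx (F y)) dM.
  by move=> i j; rewrite mxE.
have /eqP : dM *m F x + invmx (F x) *m dF = 0.
  apply/matrixP => i j; rewrite [RHS]mxE.
  have [_ /= <-] := mx_is_derive_mul hW hF i j.
  have D1 := is_derive_const ((1%:M : 'M[R]_p) i j) x v.
  apply: derive_val; apply: is_derive_congr_open oD Dx _ D1.
  by move=> y /set_mem Dy /=; rewrite mulVmx ?uF.
rewrite addr_eq0 => /eqP dME; rewrite -mulNmx -dME -mulmxA mulmxV ?mulmx1 ?uF //.
Qed.

(** * Partial derivatives on an open set *)

Section OpenSets.
Variables (R : realType) (n : nat) (V : set 'rV[R]_n).
Hypothesis openV : open V.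

Lemma derivable_congr_open (f g : 'rV[R]_n -> R) x v :
  V x -> {in V, f =1 g} -> derivable f x v -> derivable g x v.
Proof.
move=> Vx fg /derivableP hf.
by case: (is_derive_congr_open openV Vx fg hf).
Qed.

Lemma partial_congr (f g : 'rV[R]_n -> R) i x :
  V x -> {in V, f =1 g} -> partial i f x = partial i g x.
Proof.
move=> Vx fg; apply: near_eq_derive.
have := open_nbhs_nbhs (conj openV Vx); apply: filterS => y Dy.
by apply: fg; rewrite inE.
Qed.

(** Meant for the difference quotients of a curve of tensors. Each step of the induction
    differentiates the previous identity, which must therefore hold on all of [V] and not at one
    point only. *)
Lemma iter_partial_scaled_sub (s : seq 'I_n) (a : R) (f g : 'rV[R]_n -> R) :
  smooth_on V f -> smooth_on V g ->
  {in V, iter_partial s (fun x => a * (f x - g x)) =1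
         fun x => a * (iter_partial s f x - iter_partial s g x)}.
Proof.
move=> sf sg; elim: s => [|i s IH] x //= Vx.
rewrite -/(iter_partial s _) (partial_congr _ (set_mem Vx) IH).
have D h : smooth_on V h -> is_derive x (delta_mx 0 i) (iter_partial s h)
    (partial i (iter_partial s h) x).
  by move=> sh; apply/derivableP/diff_derivable/sh/set_mem.
exact: (@derive_val _ _ _ _ _ _ _ (is_derive_scale a (is_derive_sub (D _ sf) (D _ sg)))).
Qed.

End OpenSets.

(** * Time derivatives that commute with spatial derivatives *)

Section Evolution.
Variables (R : realType) (n : nat) (I : set R) (V : set 'rV[R]_n).
Hypotheses (openI : open I) (openV : open V).
Implicit Types (f g : R -> 'rV[R]_n -> R).

Local Notation e i := (delta_mx 0 i : 'rV[R]_n).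

(* [f'] is the time derivative of [f], and it commutes with the first order
   partial derivatives in space. *)
Definition evolves f f' := forall s x, I s -> V x ->
  is_derive s 1 (fun r => f r x) (f' s x) /\
  forall i, [/\ derivable (f s) x (e i), derivable (f' s) x (e i) &
    is_derive s 1 (fun r => partial i (f r) x) (partial i (f' s) x)].

Lemma evolves_congr f g f' :
  (forall s, I s -> {in V, f s =1 g s}) -> evolves f f' -> evolves g f'.
Proof.
move=> fg hf s x Is Vx; have [h1 h2] := hf s x Is Vx; split.
  apply: is_derive_congr_open openI Is _ h1 => r Ir.
  by apply: fg; rewrite ?inE //; exact/set_mem.
move=> i; have [d1 d2 d3] := h2 i; split; [|exact: d2|].
  by refine (derivable_congr_open openV Vx _ d1); exact: fg.
apply: is_derive_congr_open openI Is _ d3 => r /set_mem Ir.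
exact: (partial_congr openV i Vx (fg r Ir)).
Qed.

Lemma evolves_congr_deriv f f' g' :
  (forall s, I s -> {in V, f' s =1 g' s}) -> evolves f f' -> evolves f g'.
Proof.
move=> fg hf s x Is Vx; have [h1 h2] := hf s x Is Vx; split.
  by rewrite -(fg _ Is) ?inE.
move=> i; have [d1 d2 d3] := h2 i; split; [exact: d1| |].
  exact: (derivable_congr_open openV Vx (fg s Is) d2).
by rewrite -(partial_congr openV i Vx (fg s Is)).
Qed.

Lemma partialE (f : 'rV[R]_n -> R) x i df :
  is_derive x (e i) f df -> partial i f x = df.
Proof. by case. Qed.

Lemma evolves_const a : evolves (fun _ _ => a) (fun _ _ => 0).
Proof.
move=> s x _ _; split=> [|i]; first exact: is_derive_const.
split; [exact: derivable_cst|exact: derivable_cst|].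
under eq_fun do rewrite (partialE (is_derive_const a _ _)).
by rewrite (partialE (is_derive_const 0 _ _)); exact: is_derive_const.
Qed.

Lemma evolves_add f g f' g' : evolves f f' -> evolves g g' ->
  evolves (fun s x => f s x + g s x) (fun s x => f' s x + g' s x).
Proof.
move=> hf hg s x Is Vx.
have [f1 f2] := hf s x Is Vx; have [g1 g2] := hg s x Is Vx.
split=> [|i]; first exact: is_derive_add.
have [fi fi' fii] := f2 i; have [gi gi' gii] := g2 i.
split; [exact: derivableD|exact: derivableD|].
rewrite (partialE (is_derive_add (derivableP fi') (derivableP gi'))).
apply: is_derive_congr_open openI Is _ (is_derive_add fii gii) => r /set_mem Ir.
have [+ _ _] := (hf r x Ir Vx).2 i; have [+ _ _] := (hg r x Ir Vx).2 i.
move=> gr fr.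
by rewrite (partialE (is_derive_add (derivableP fr) (derivableP gr))).
Qed.

Lemma evolves_mul f g f' g' : evolves f f' -> evolves g g' ->
  evolves (fun s x => f s x * g s x) (fun s x => f' s x * g s x + f s x * g' s x).
Proof.
move=> hf hg s x Is Vx.
have [f1 f2] := hf s x Is Vx; have [g1 g2] := hg s x Is Vx.
split=> [|i]; first exact: is_derive_mul.
have [fi fi' fii] := f2 i; have [gi gi' gii] := g2 i.
have D1 := is_derive_mul (derivableP fi') (derivableP gi).
have D2 := is_derive_mul (derivableP fi) (derivableP gi').
have D := is_derive_add D1 D2.
split; [refine (is_derive_derivable (is_derive_mul (derivableP fi) (derivableP gi)))|exact (is_derive_derivable D)|].
rewrite (partialE D).
(* The time derivative of the spatial product rule and the spatial derivative of the time product
   rule consist of the same four products. *)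
have T := is_derive_add (is_derive_mul fii g1) (is_derive_mul f1 gii).
have {}T := is_derive_eq T (_ : _ = ('D_(e i) (f' s) x * g s x + f' s x * 'D_(e i) (g s) x
  + ('D_(e i) (f s) x * g' s x + f s x * 'D_(e i) (g' s) x))).
apply: is_derive_congr_open openI Is _ (T _) => [r /set_mem Ir|].
  have [+ _ _] := (hf r x Ir Vx).2 i; have [+ _ _] := (hg r x Ir Vx).2 i.
  move=> gr fr.
  by rewrite (partialE (is_derive_mul (derivableP fr) (derivableP gr))).
by rewrite /partial; ring.
Qed.

Lemma evolves_sub f g f' g' : evolves f f' -> evolves g g' ->
  evolves (fun s x => f s x - g s x) (fun s x => f' s x - g' s x).
Proof.
move=> hf hg.
have H := evolves_add hf (evolves_mul (evolves_const (-1)) hg).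
apply: evolves_congr_deriv (evolves_congr _ H) => s _ x _.
  by rewrite mul0r add0r mulN1r.
by rewrite mulN1r.
Qed.

Lemma evolves_inv f f' :
  (forall s x, I s -> V x -> f s x != 0) -> evolves f f' ->
  evolves (fun s x => (f s x)^-1) (fun s x => - (f s x) ^- 2 * f' s x).
Proof.
move=> f0 hf s x Is Vx; have [f1 f2] := hf s x Is Vx.
have fsx0 := f0 _ _ Is Vx.
split=> [|i]; first exact: is_derive_inv.
have [fi fi' fii] := f2 i.
(* Stated over any normed space, since it serves both the spatial and the time direction. *)
have sq (W : normedModType R) (h : W -> R) (y v : W) dh : is_derive y v h dh -> h y != 0 ->
    is_derive y v (fun z => - (h z) ^- 2) (2 * (h y) ^- 3 * dh).
  move=> hh hy0.
  have h2 : h y * h y != 0 by rewrite mulf_neq0.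
  have D := is_derive_opp (is_derive_inv (f := fun z => h z * h z) h2 (is_derive_mul hh hh)).
  by apply: is_derive_eq D _; field.
have D := is_derive_mul (sq _ _ _ _ _ (derivableP fi) fsx0) (derivableP fi').
split; [exact (is_derive_derivable (is_derive_inv fsx0 (derivableP fi)))|exact (is_derive_derivable D)|].
rewrite (partialE D).
have T := is_derive_mul (sq _ _ _ _ _ f1 fsx0) fii.
have {}T := is_derive_eq T (_ : _ = 2 * f s x ^- 3 * 'D_(e i) (f s) x * f' s x +
   - f s x ^- 2 * 'D_(e i) (f' s) x).
apply: is_derive_congr_open openI Is _ (T _) => [r /set_mem Ir|].
  have [+ _ _] := (hf r x Ir Vx).2 i => fr.
  by rewrite (partialE (is_derive_inv (f0 _ _ Ir Vx) (derivableP fr))).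
by rewrite /partial; ring.
Qed.

Lemma evolves_sum (J : Type) (r : seq J) (P : pred J)
    (f f' : J -> R -> 'rV[R]_n -> R) :
  (forall j, evolves (f j) (f' j)) ->
  evolves (fun s x => \sum_(j <- r | P j) f j s x)
          (fun s x => \sum_(j <- r | P j) f' j s x).
Proof.
move=> hf; elim: r => [|j r IH].
  have -> : (fun s x => \sum_(j <- [::] | P j) f' j s x) = fun _ _ => 0.
    by apply/funext => s; apply/funext => x; rewrite big_nil.
  by apply: evolves_congr (evolves_const 0) => s _ x _; rewrite big_nil.
case Pj : (P j); last first.
  have -> : (fun s x => \sum_(j <- j :: r | P j) f' j s x) =
      fun s x => \sum_(j <- r | P j) f' j s x.
    by apply/funext => s; apply/funext => x; rewrite big_cons Pj.
  by apply: evolves_congr IH => s _ x _; rewrite big_cons Pj.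
have -> : (fun s x => \sum_(j <- j :: r | P j) f' j s x) =
    fun s x => f' j s x + \sum_(j <- r | P j) f' j s x.
  by apply/funext => s; apply/funext => x; rewrite big_cons Pj.
by apply: evolves_congr (evolves_add (hf j) IH) => s _ x _; rewrite big_cons Pj.
Qed.

(** Leaves the time derivative anonymous; for inverse matrices its formula is recovered afterwards
    from uniqueness of derivatives. *)
Definition evolving f := exists f', evolves f f'.

Lemma evolving_prod (J : Type) (r : seq J) (f : J -> R -> 'rV[R]_n -> R) :
  (forall j, evolving (f j)) -> evolving (fun s x => \prod_(j <- r) f j s x).
Proof.
move=> hf; elim: r => [|j r [h hh]].
  exists (fun _ _ => 0).
  by apply: evolves_congr (evolves_const 1) => s _ x _; rewrite big_nil.
have [f' hf'] := hf j; eexists.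
by apply: evolves_congr (evolves_mul hf' hh) => s _ x _; rewrite big_cons.
Qed.

Lemma evolving_det p (F : R -> 'rV[R]_n -> 'M[R]_p) :
  (forall i j, evolving (fun s x => F s x i j)) ->
  evolving (fun s x => \det (F s x)).
Proof.
move=> hF; have H (s : 'S_p) := evolving_prod (index_enum 'I_p) (fun i => hF i (s i)).
have [h hh] := choice H; eexists.
apply: evolves_sum => s; apply: evolves_mul (evolves_const _) (hh s).
Qed.

(** By Cramer's formula each entry is a cofactor over the determinant, and both are polynomial in
    the entries of [F]. *)
Lemma evolving_invmx p (F : R -> 'rV[R]_n -> 'M[R]_p) :
  (forall s x, I s -> V x -> F s x \in unitmx) ->
  (forall i j, evolving (fun s x => F s x i j)) ->
  forall i j, evolving (fun s x => invmx (F s x) i j).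
Proof.
move=> uF hF i j.
have [d hd] := evolving_det hF.
have [c hc] : evolving (fun s x => cofactor (F s x) j i).
  have [h hh] : evolving (fun s x => \det (row' j (col' i (F s x)))).
    apply: evolving_det => a b; have [k hk] := hF (lift j a) (lift i b).
    by exists k; apply: evolves_congr hk => s _ x _; rewrite !mxE.
  by eexists; exact: evolves_mul (evolves_const _) hh.
have d0 s x : I s -> V x -> \det (F s x) != 0.
  by move=> Is Vx; rewrite -unitfE -unitmxE; exact: uF.
eexists; apply: evolves_congr (evolves_mul (evolves_inv d0 hd) hc).
move=> s Is x /set_mem Vx; rewrite /invmx uF //.
by rewrite !mxE.
Qed.

End Evolution.

(** * Variation of the Levi-Civita connection *)

Lemma trace_mulmxE (R : pzRingType) (p : nat) (A B : 'M[R]_p) :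
  \tr (A *m B) = \sum_i \sum_j A i j * B j i.
Proof. by apply: eq_bigr => i _; rewrite mxE. Qed.

Lemma mxtraceB (R : pzRingType) (p : nat) (A B : 'M[R]_p) :
  \tr (A - B) = \tr A - \tr B.
Proof. exact: (raddfB (@mxtrace R p)). Qed.

Lemma sym_mx_entry (T : Type) (p : nat) (A : 'M[T]_p) i j :
  A^T = A -> A i j = A j i.
Proof. by move=> Asym; rewrite -[in RHS]Asym mxE. Qed.

Section VariationOfConnection.
Variables (R : realType) (n : nat).
Implicit Types (g h : lfield R n).

(* The derivative of the Christoffel symbols in the direction [h]. *)
Definition christoffel_var g h (k i j : 'I_n) : 'rV[R]_n -> R := fun x =>
  2^-1 * \sum_l invmx (g x) k l *
    (nabla2 g h i j l x + nabla2 g h j i l x - nabla2 g h l i j x).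

(* The derivative of the Ricci tensor in the direction [h]. *)
Definition ricci_var g h : lfield R n := fun x => \matrix_(j, k) \sum_i
  (partial i (christoffel_var g h i j k) x - partial j (christoffel_var g h i i k) x
  + \sum_m (christoffel_var g h i i m x * christoffel g m j k x
            + christoffel g i i m x * christoffel_var g h m j k x
            - (christoffel_var g h i j m x * christoffel g m i k x
               + christoffel g i j m x * christoffel_var g h m i k x))).

End VariationOfConnection.

(** * Levi-Civita calculus of one metric in a chart *)

Section LocalMetric.
Variables (R : realType) (n : nat) (V : set 'rV[R]_n) (g : lfield R n).
Hypotheses (openV : open V) (gsym : forall x, V x -> (g x)^T = g x)
  (gunit : forall x, V x -> g x \in unitmx)
  (dg : forall x i a b, V x -> derivable (fun y => g y a b) x (delta_mx 0 i)).
Implicit Types (x : 'rV[R]_n) (h : lfield R n).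

Local Notation w x := (invmx (g x)).

Definition partial_mx h (l : 'I_n) x : 'M[R]_n :=
  \matrix_(a, b) partial l (fun y => h y a b) x.

Definition christoffel_mx (l : 'I_n) x : 'M[R]_n :=
  \matrix_(m, i) christoffel g m l i x.

(** Covariant differentiation as matrix algebra. The upper index is the row index of
    [christoffel_mx], whence the transpose in the left factor. *)
Definition nabla_mx h l x : 'M[R]_n :=
  partial_mx h l x - (christoffel_mx l x)^T *m h x - h x *m christoffel_mx l x.

Lemma metric_entryC x a b : V x -> g x a b = g x b a.
Proof. by move=> Vx; apply/sym_mx_entry/gsym. Qed.

Lemma inverse_metric_sym x : V x -> (w x)^T = w x.
Proof. by move=> Vx; rewrite trmx_inv gsym. Qed.

Lemma partial_symC h l a b x : (forall y, V y -> (h y)^T = h y) -> V x ->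
  partial l (fun y => h y a b) x = partial l (fun y => h y b a) x.
Proof.
move=> hsym Vx; apply: (partial_congr openV l Vx) => y /set_mem Vy.
by rewrite -[in RHS]hsym // mxE.
Qed.

Lemma christoffelC m i j x : V x -> christoffel g m i j x = christoffel g m j i x.
Proof.
move=> Vx; congr (_ * _); apply: eq_bigr => l _; congr (_ * (_ - _)).
  exact: addrC.
exact: partial_symC gsym Vx.
Qed.

Lemma lower_christoffel l i j x : V x ->
  \sum_m g x l m * christoffel g m i j x =
  2^-1 * (partial i (fun y => g y j l) x + partial j (fun y => g y i l) x
     - partial l (fun y => g y i j) x).
Proof.
move=> Vx.
pose c := \col_l (partial i (fun y => g y j l) x + partial j (fun y => g y i l) x
     - partial l (fun y => g y i j) x).
transitivity (2^-1 * (g x *m (w x *m c)) l 0); last first.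
  by rewrite mulmxA mulmxV ?gunit // mul1mx mxE.
rewrite mxE big_distrr; apply: eq_bigr => m _.
rewrite mulrCA; congr (_ * (_ * _)); rewrite mxE.
by apply: eq_bigr => k _; rewrite mxE.
Qed.

Lemma nabla_mxE h i k j x : nabla_mx h i x k j = nabla2 g h i k j x.
Proof.
rewrite !mxE /nabla2 -addrA -opprD -big_split /=; congr (_ - _).
by apply: eq_bigr => m _; rewrite !mxE [h x k m * _]mulrC.
Qed.

(** Lowering the upper index turns both connection terms into Christoffel symbols of the first kind,
    whose sum is the partial derivative of the metric. *)
Lemma nabla_metric l x : V x -> nabla_mx g l x = 0.
Proof.
move=> Vx; apply/matrixP => a b; rewrite nabla_mxE [RHS]mxE /nabla2 big_split /=.
have E i j : \sum_m christoffel g m l i x * g x m j =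
   2^-1 * (partial l (fun y => g y i j) x + partial i (fun y => g y l j) x
     - partial j (fun y => g y l i) x).
  rewrite -lower_christoffel //; apply: eq_bigr => m _.
  by rewrite mulrC (metric_entryC _ _ Vx).
have -> : \sum_m christoffel g m l b x * g x a m =
    \sum_m christoffel g m l b x * g x m a.
  by apply: eq_bigr => m _; rewrite (metric_entryC _ _ Vx).
rewrite !E [partial l (fun y => g y b a) x](partial_symC _ _ _ gsym Vx).
by field.
Qed.

Lemma mx_is_derive_partial h l x :
  (forall a b, derivable (fun y => h y a b) x (delta_mx 0 l)) ->
  mx_is_derive x (delta_mx 0 l) h (partial_mx h l x).
Proof. by move=> dh a b; rewrite mxE; exact: derivableP. Qed.

(** The inverse metric is parallel: in [- g^-1 (d_l g) g^-1] the factor [d_l g] is replaced by its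
    connection terms, using [nabla_metric]. *)
Lemma partial_inverse_metric l x : V x ->
  mx_is_derive x (delta_mx 0 l) (fun y => w y)
    (- (w x *m (christoffel_mx l x)^T) - christoffel_mx l x *m w x).
Proof.
move=> Vx.
have H := mx_is_derive_inv openV Vx gunit (mx_is_derive_partial (fun a b => dg Vx)).
suff <- : - (w x *m partial_mx g l x *m w x) =
    - (w x *m (christoffel_mx l x)^T) - christoffel_mx l x *m w x by [].
have /eqP := nabla_metric l Vx; rewrite /nabla_mx -addrA -opprD subr_eq0 => /eqP ->.
rewrite mulmxDr mulmxDl !mulmxA mulVmx ?gunit // mul1mx -!mulmxA mulmxV ?gunit //.
by rewrite mulmx1 opprD.
Qed.

Lemma nabla_mx_sym h l x : (forall y, V y -> (h y)^T = h y) -> V x ->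
  (nabla_mx h l x)^T = nabla_mx h l x.
Proof.
move=> hsym Vx; rewrite /nabla_mx !raddfB /= !trmx_mul trmxK hsym //.
rewrite addrAC; congr (_ - _ - _); apply/matrixP => a b.
by rewrite !mxE; apply: partial_symC hsym Vx.
Qed.

(** The trace commutes with covariant differentiation: by cyclicity of the trace, the terms coming
    from the inverse metric are the connection terms of [nabla_mx]. *)
Lemma partial_trg h l x : V x ->
  (forall a b, derivable (fun y => h y a b) x (delta_mx 0 l)) ->
  is_derive x (delta_mx 0 l) (trg g h) (\tr (w x *m nabla_mx h l x)).
Proof.
move=> Vx dh.
have D := mx_is_derive_mul (partial_inverse_metric l Vx) (mx_is_derive_partial dh).
apply: is_derive_eq (is_derive_trace D) _.
rewrite /nabla_mx !mulmxBr mulmxBl mulNmx !raddfD !raddfN /= addrC -!mulmxA.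
by rewrite -addrA; congr (_ + (_ - _)); rewrite mxtrace_mulC -!mulmxA.
Qed.

(* Raising the index of [om] turns its covariant divergence into
   [d_i X^i + Gamma^i_im X^m]. *)
Lemma divergence_form (om : lform R n) x : V x ->
  (forall i j, derivable (fun y => om y 0 j) x (delta_mx 0 i)) ->
  \sum_i (partial i (fun y => \sum_j w y i j * om y 0 j) x
    + \sum_m christoffel g i i m x * \sum_j w x m j * om x 0 j)
  = - delta1 g om x.
Proof.
move=> Vx dom; rewrite opprK; apply: eq_bigr => i _.
have D j := is_derive_mul (partial_inverse_metric i Vx i j)
  (derivableP (dom i j)).
rewrite (partialE (is_derive_bigsum (index_enum 'I_n) xpredT D)) big_split /=.
(* The first sum supplies the connection term of [nabla1]; the second cancels the contracted
   Christoffel term, for each [i] separately. *)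
have -> : \sum_j (- (w x *m (christoffel_mx i x)^T) - christoffel_mx i x *m w x) i j
      * om x 0 j =
    - \sum_j w x i j * (\sum_m christoffel g m i j x * om x 0 m)
    - \sum_m christoffel g i i m x * (\sum_j w x m j * om x 0 j).
  under eq_bigr do rewrite !mxE mulrDl !mulNr !big_distrl /=.
  rewrite big_split /= !sumrN; congr (- _ - _); rewrite exchange_big /=;
    apply: eq_bigr => m _; rewrite big_distrr /=;
    by apply: eq_bigr => j _; rewrite !mxE -mulrA.
under [in RHS]eq_bigr do rewrite mulrBr.
rewrite [in RHS]big_split /= sumrN -/(partial _ _ _).
by rewrite addrAC subrK addrC.
Qed.

(** * Variation of the connection and of the Ricci tensor *)

Section Variation.
Variable h : lfield R n.
Hypotheses (hsym : forall x, V x -> (h x)^T = h x)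
  (dh : forall x i a b, V x -> derivable (fun y => h y a b) x (delta_mx 0 i))
  (dA : forall x l k i j, V x ->
    derivable (christoffel_var g h k i j) x (delta_mx 0 l)).

Local Notation A := (christoffel_var g h).

(** The upper index is frozen, so that A^i_jk can be treated as a (0,2)-field by [nabla_mx]; the
    connection term of the upper index is added separately. *)
Definition christoffel_var_mx (i : 'I_n) x : 'M[R]_n := \matrix_(j, k) A i j k x.

(** The two contractions of the tensor A: the vector field g^jk A^i_jk, and below it the one-form
    A^i_ij. *)
Definition var_contr (i : 'I_n) : 'rV[R]_n -> R := trg g (christoffel_var_mx i).
Definition var_trace (j : 'I_n) x : R := \sum_i A i i j x.

Lemma nabla2C i k j x : V x -> nabla2 g h i k j x = nabla2 g h i j k x.
Proof. by move=> Vx; rewrite -!nabla_mxE; exact/sym_mx_entry/nabla_mx_sym. Qed.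

Lemma lower_christoffel_var l i j x : V x ->
  \sum_m g x l m * A m i j x =
  2^-1 * (nabla2 g h i j l x + nabla2 g h j i l x - nabla2 g h l i j x).
Proof.
move=> Vx.
pose c := \col_l (nabla2 g h i j l x + nabla2 g h j i l x - nabla2 g h l i j x).
transitivity (2^-1 * (g x *m (w x *m c)) l 0); last first.
  by rewrite mulmxA mulmxV ?gunit // mul1mx mxE.
rewrite mxE big_distrr; apply: eq_bigr => m _.
rewrite mulrCA; congr (_ * (_ * _)); rewrite mxE.
by apply: eq_bigr => k _; rewrite mxE.
Qed.

Lemma inverse_metricC x a b : V x -> w x a b = w x b a.
Proof. by move=> Vx; apply/sym_mx_entry/inverse_metric_sym. Qed.

(** The other two covariant derivatives in A^i_ij form an expression antisymmetric in [i] and [l],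
    which vanishes against the symmetric inverse metric. *)
Lemma var_traceE j x : V x -> var_trace j x = 2^-1 * \tr (w x *m nabla_mx h j x).
Proof.
move=> Vx; rewrite /var_trace -big_distrr /=; congr (_ * _).
rewrite trace_mulmxE.
transitivity (\sum_i \sum_l w x i l * nabla_mx h j x l i +
  (\sum_i \sum_l w x i l * nabla2 g h i j l x - \sum_i \sum_l w x i l * nabla2 g h l i j x)).
  rewrite -sumrB -big_split /=; apply: eq_bigr => i _.
  rewrite -sumrB -big_split /=; apply: eq_bigr => l _.
  by rewrite nabla_mxE (nabla2C j l i Vx) mulrBr mulrDr addrCA addrA addrAC.
rewrite [X in _ + (_ - X)]exchange_big /= -sumrB [X in _ + X]big1 ?addr0 // => i _.
by rewrite -sumrB big1 // => l _; rewrite (inverse_metricC l i Vx) (nabla2C i l j Vx) subrr.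
Qed.

(** [var_trace] is half the differential of the trace of [h]. Lowering the index of [var_contr]
    gives g^ik nabla_i h_kj minus another half, so the difference is [deltam]. *)
Lemma deltam_contractions j x : V x ->
  deltam g h x 0 j = var_trace j x - \sum_i g x j i * var_contr i x.
Proof.
move=> Vx; rewrite var_traceE // !mxE.
rewrite (partialE (partial_trg Vx (fun a b => dh Vx))).
have -> : \sum_i g x j i * var_contr i x =
    \sum_i \sum_k w x i k * nabla2 g h i k j x - 2^-1 * \tr (w x *m nabla_mx h j x).
  transitivity (\sum_a \sum_b w x a b * \sum_i g x j i * A i b a x).
    transitivity (\sum_i \sum_a \sum_b w x a b * (g x j i * A i b a x)).
      apply: eq_bigr => i _; rewrite /var_contr /trg trace_mulmxE big_distrr.
      apply: eq_bigr => a _; rewrite big_distrr; apply: eq_bigr => b _.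
      by rewrite mxE; exact: mulrCA.
    rewrite exchange_big; apply: eq_bigr => a _.
    rewrite exchange_big; apply: eq_bigr => b _.
    by rewrite big_distrr.
  under eq_bigr do under eq_bigr do rewrite lower_christoffel_var //.
  transitivity (2^-1 * (\sum_a \sum_b w x a b * nabla2 g h a b j x +
      \sum_a \sum_b w x a b * nabla2 g h b a j x -
      \tr (w x *m nabla_mx h j x))).
    rewrite trace_mulmxE -big_split -sumrB big_distrr /=; apply: eq_bigr => a _.
    rewrite -big_split -sumrB big_distrr /=; apply: eq_bigr => b _.
    rewrite nabla_mxE mulrCA; congr (_ * _).
    by rewrite mulrBr mulrDr [X in X - _ = _]addrC.
  have -> : \sum_a \sum_b w x a b * nabla2 g h b a j x =
      \sum_a \sum_b w x a b * nabla2 g h a b j x.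
    rewrite exchange_big /=; apply: eq_bigr => a _; apply: eq_bigr => b _.
    by rewrite inverse_metricC.
  by field.
by field.
Qed.


(** Palatini's identity: the first and last sums together are nabla_i A^i_jk, the last one being the
    connection term of the upper index, and the middle matrix is nabla_j A^i_ik. *)
Lemma ricci_var_mxE x : V x ->
  ricci_var g h x = \sum_i nabla_mx (christoffel_var_mx i) i x
    - \matrix_(j, k) nabla1 g (fun y => \row_l var_trace l y) j k x
    + \sum_m (\sum_i christoffel g i i m x) *: christoffel_var_mx m x.
Proof.
move=> Vx; apply/matrixP => j k.
have -> : ricci_var g h x j k = \sum_i partial i (A i j k) x
    - \sum_i partial j (A i i k) x
    + (\sum_i \sum_m A i i m x * christoffel g m j k x
       + \sum_i \sum_m christoffel g i i m x * A m j k x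
       - (\sum_i \sum_m A i j m x * christoffel g m i k x
          + \sum_i \sum_m christoffel g i j m x * A m i k x)).
  rewrite mxE big_split sumrB; congr (_ + _).
  rewrite -!big_split -sumrB; apply: eq_bigr => i _.
  by rewrite -!big_split -sumrB.
have E1 : (\sum_i nabla_mx (christoffel_var_mx i) i x) j k =
    \sum_i partial i (A i j k) x
    - (\sum_i \sum_m A i j m x * christoffel g m i k x
       + \sum_i \sum_m christoffel g i j m x * A m i k x).
  rewrite summxE [X in _ - (_ + X)]exchange_big -big_split -sumrB.
  apply: eq_bigr => i _; rewrite nabla_mxE /nabla2; congr (_ - _).
    by congr (partial i _ x); apply/funext => y; rewrite mxE.
  rewrite -big_split; apply: eq_bigr => m _; rewrite !mxE [RHS]addrC.
  by rewrite (christoffelC m i j Vx); congr (_ + _); exact: mulrC.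
have E2 : nabla1 g (fun y => \row_l var_trace l y) j k x =
    \sum_i partial j (A i i k) x - \sum_i \sum_m A i i m x * christoffel g m j k x.
  rewrite /nabla1; congr (_ - _).
    have D := is_derive_bigsum (index_enum 'I_n) xpredT
      (fun i => derivableP (@dA x j i i k Vx)).
    by rewrite -(partialE D); congr (partial j _ x); apply/funext => y; rewrite mxE.
  rewrite exchange_big; apply: eq_bigr => m _; rewrite mxE mulrC.
  by rewrite /var_trace big_distrl.
have E3 : (\sum_m (\sum_i christoffel g i i m x) *: christoffel_var_mx m x) j k =
    \sum_i \sum_m christoffel g i i m x * A m j k x.
  rewrite summxE exchange_big; apply: eq_bigr => m _.
  by rewrite !mxE big_distrl.
by rewrite [RHS]mxE E3 [in RHS]mxE E1 [in RHS]mxE [in RHS]mxE E2; ring.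
Qed.

(** As traces commute with nabla, the left side is the divergence of [var_contr] plus the
    codifferential of [var_trace]. By [deltam_contractions] and [divergence_form] this is the
    codifferential of [deltam]. *)
Lemma trace_ricci_var x : V x ->
  \tr (w x *m ricci_var g h x) = delta1 g (deltam g h) x.
Proof.
move=> Vx.
pose v : lform R n := fun y => \row_l var_trace l y.
have vE0 l y : v y 0 l = var_trace l y by rewrite mxE.
have vE l : (fun y => v y 0 l) = var_trace l by apply/funext.
have dv i l y : V y -> derivable (fun y => v y 0 l) y (delta_mx 0 i).
  move=> Vy; rewrite vE.
  have D := is_derive_bigsum (index_enum 'I_n) xpredT
    (fun i' => derivableP (@dA y i i' i' l Vy)).
  exact (is_derive_derivable D).
have dU i a y : V y -> derivable (var_contr a) y (delta_mx 0 i).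
  move=> Vy; refine (is_derive_derivable (partial_trg Vy _)) => b c.
  have -> : (fun y => christoffel_var_mx a y b c) = A a b c.
    by apply/funext => z; rewrite mxE.
  exact: dA.
have omE j : {in V, (fun y => v y 0 j - \sum_i g y j i * var_contr i y) =1
    (fun y => deltam g h y 0 j)}.
  by move=> y /set_mem Vy /=; rewrite deltam_contractions // vE0.
have dom i j y : V y -> derivable (fun y => deltam g h y 0 j) y (delta_mx 0 i).
  move=> Vy.
  have D := is_derive_sub (derivableP (dv i j y Vy)) (is_derive_bigsum
    (index_enum 'I_n) xpredT
    (fun a => is_derive_mul (derivableP (@dg y i j a Vy)) (derivableP (dU i a y Vy)))).
  exact (derivable_congr_open openV Vy (omE j) (is_derive_derivable D)).
apply: oppr_inj; rewrite -divergence_form //; last by move=> i j; exact: dom.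
(* Raising the index of [deltam] undoes the lowering of [var_contr], so no derivative of the metric
   itself is left on that term. *)
have raise i : {in V, (fun y => \sum_j w y i j * v y 0 j - var_contr i y) =1
    (fun y => \sum_j w y i j * deltam g h y 0 j)}.
  move=> y Vy; apply/esym.
  under eq_bigr do rewrite -omE // mulrBr.
  rewrite sumrB; congr (_ - _).
  pose U := \col_i var_contr i y.
  transitivity ((w y *m (g y *m U)) i 0).
    rewrite mxE; apply: eq_bigr => j _; rewrite mxE; congr (_ * _).
    by apply: eq_bigr => k _; rewrite mxE.
  by rewrite mulmxA mulVmx ?gunit ?mul1mx ?mxE //; exact: set_mem.
have E i : partial i (fun y => \sum_j w y i j * deltam g h y 0 j) x =
    partial i (fun y => \sum_j w y i j * v y 0 j) x - partial i (var_contr i) x.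
  rewrite -(partial_congr openV i Vx (raise i)); apply: partialE.
  apply: is_derive_sub; apply: derivableP; last exact: dU.
  have D := is_derive_bigsum (index_enum 'I_n) xpredT (fun j =>
    is_derive_mul (partial_inverse_metric i Vx i j) (derivableP (dv i j x Vx))).
  exact (is_derive_derivable D).
transitivity (- delta1 g v x
    - \sum_i (partial i (var_contr i) x
        + \sum_m christoffel g i i m x * var_contr m x)); last first.
  rewrite -divergence_form //; last by move=> i j; exact: dv.
  rewrite -sumrB; apply: eq_bigr => i _; rewrite E opprD addrACA; congr (_ + _).
  rewrite -sumrB; apply: eq_bigr => m _.
  by rewrite -mulrBr -(raise m x (mem_set Vx)).
have -> : delta1 g v x = - \tr (w x *m \matrix_(j, k) nabla1 g v j k x).
  rewrite mxtrace_mulC trace_mulmxE; congr (- _); apply: eq_bigr => i _.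
  by apply: eq_bigr => j _; rewrite mxE (inverse_metricC i j Vx) mulrC.
have tr_sum (F : 'I_n -> 'M[R]_n) :
    \tr (w x *m \sum_i F i) = \sum_i \tr (w x *m F i).
  by rewrite mulmx_sumr (raddf_sum (@mxtrace R n)).
have EU i : partial i (var_contr i) x =
    \tr (w x *m nabla_mx (christoffel_var_mx i) i x).
  apply/partialE/partial_trg => // a b.
  have -> : (fun y => christoffel_var_mx i y a b) = A i a b.
    by apply/funext => y; rewrite mxE.
  exact: dA.
have EG : \sum_i \sum_m christoffel g i i m x * var_contr m x =
    \sum_m \tr (w x *m ((\sum_i christoffel g i i m x) *: christoffel_var_mx m x)).
  rewrite exchange_big; apply: eq_bigr => m _.
  by rewrite -scalemxAr mxtraceZ big_distrl.
rewrite ricci_var_mxE // mulmxDr mulmxBr mxtraceD mxtraceB !tr_sum big_split.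
by rewrite [X in _ - (X + _)](eq_bigr _ (fun i _ => EU i)) EG; ring.
Qed.

End Variation.
End LocalMetric.

(** * Curves of metrics *)

Section LocalEvolution.
Variables (R : realType) (n : nat) (I : set R) (V : set 'rV[R]_n).
Variables g h : R -> lfield R n.
Hypotheses (openI : open I) (openV : open V)
  (gsym : forall s x, I s -> V x -> (g s x)^T = g s x)
  (hsym : forall s x, I s -> V x -> (h s x)^T = h s x)
  (gunit : forall s x, I s -> V x -> g s x \in unitmx)
  (evg : forall a b, evolves I V (fun s x => g s x a b) (fun s x => h s x a b))
  (evdg : forall l a b, evolves I V
     (fun s => partial l (fun y => g s y a b))
     (fun s => partial l (fun y => h s y a b))).

Local Notation w s x := (invmx (g s x)).

Lemma evolves_metric_mx s x : I s -> V x ->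
  mx_is_derive s 1 (fun r => g r x) (h s x).
Proof. by move=> Is Vx a b; case: (evg a b Is Vx). Qed.

Lemma derivable_metric s x i a b : I s -> V x ->
  derivable (fun y => g s y a b) x (delta_mx 0 i).
Proof. move=> Is Vx; have [_ /(_ i)[d _ _]] := evg a b Is Vx; exact d. Qed.

Lemma derivable_variation s x i a b : I s -> V x ->
  derivable (fun y => h s y a b) x (delta_mx 0 i).
Proof. move=> Is Vx; have [_ /(_ i)[_ d _]] := evg a b Is Vx; exact d. Qed.

Lemma inverse_mx_is_derive s x : I s -> V x ->
  mx_is_derive s 1 (fun r => w r x) (- (w s x *m h s x *m w s x)).
Proof.
move=> Is Vx; apply: (mx_is_derive_inv openI Is _ (evolves_metric_mx Is Vx)).
by move=> r Ir; exact: gunit.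
Qed.

(** Cramer's formula provides a time derivative commuting with [partial]; uniqueness identifies it
    with the explicit matrix. *)
Lemma inverse_evolves i j : evolves I V (fun s x => w s x i j)
  (fun s x => (- (w s x *m h s x *m w s x)) i j).
Proof.
have [f' hf'] : evolving I V (fun s x => w s x i j).
  by apply: evolving_invmx => // a b; exists (fun s x => h s x a b).
apply: (evolves_congr_deriv openV _ hf') => s Is x /set_mem Vx.
have [[_ <-] _] := hf' s x Is Vx.
by have [_ <-] := inverse_mx_is_derive Is Vx i j.
Qed.

(** Differentiating the inverse metric yields -2 g^kl h_lm Gamma^m_ij. This is what remains of the
    six connection terms in [christoffel_var]: by symmetry four of them cancel in pairs and the
    other two coincide. *)
Lemma christoffel_evolves k i j : evolves I V (fun s => christoffel (g s) k i j)
  (fun s => christoffel_var (g s) (h s) k i j).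
Proof.
have E := evolves_mul openI (evolves_const 2^-1) (evolves_sum openI openV
  (index_enum 'I_n) xpredT (fun l => evolves_mul openI (inverse_evolves k l)
   (evolves_sub openI openV (evolves_add openI (evdg i j l) (evdg j i l)) (evdg l i j)))).
apply: (evolves_congr_deriv openV _ E) => s Is x /set_mem Vx.
rewrite mul0r add0r; congr (_ * _).
have gs y : V y -> (g s y)^T = g s y by exact: gsym.
have hs y : V y -> (h s y)^T = h s y by exact: hsym.
pose c := \col_l (partial i (fun y => g s y j l) x + partial j (fun y => g s y i l) x
  - partial l (fun y => g s y i j) x).
pose c' := \col_l (partial i (fun y => h s y j l) x + partial j (fun y => h s y i l) x
  - partial l (fun y => h s y i j) x).
pose ga := \col_m christoffel (g s) m i j x.
(* For fixed [i] and [j], this is the definition of the Christoffel symbols in column form. *)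
have wc : w s x *m c = 2 *: ga.
  apply/matrixP => a b; rewrite !mxE mulrA mulfV // mul1r.
  by apply: eq_bigr => l _; rewrite mxE.
transitivity ((w s x *m (c' - 2 *: (h s x *m ga))) k 0).
  rewrite mulmxBr scalemxAr -wc !mulmxA [RHS]mxE big_split addrC /=; congr (_ + _).
    by rewrite -mulNmx [RHS]mxE; apply: eq_bigr => l _; rewrite [c _ _]mxE.
  by rewrite mxE; apply: eq_bigr => l _; rewrite [c' _ _]mxE.
rewrite mxE; apply: eq_bigr => l _; congr (_ * _).
have -> : (c' - 2 *: (h s x *m ga)) l 0 =
    (partial i (fun y => h s y j l) x + partial j (fun y => h s y i l) x
     - partial l (fun y => h s y i j) x) - 2 * \sum_m h s x l m * ga m 0.
  by rewrite !mxE.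
rewrite /nabla2.
have -> : \sum_m h s x l m * ga m 0 = \sum_m christoffel (g s) m i j x * h s x m l.
  apply: eq_bigr => m _; rewrite mxE mulrC; congr (_ * _).
  exact: sym_mx_entry (hs x Vx).
rewrite !big_split /=.
have C a b : \sum_m christoffel (g s) m a b x * h s x m l =
    \sum_m christoffel (g s) m b a x * h s x m l.
  by apply: eq_bigr => m _; rewrite (christoffelC openV gs m a b Vx).
have D a b c0 : \sum_m christoffel (g s) m a b x * h s x c0 m =
    \sum_m christoffel (g s) m b a x * h s x m c0.
  apply: eq_bigr => m _; rewrite (christoffelC openV gs m a b Vx).
  by rewrite (sym_mx_entry c0 m (hs x Vx)).
have E' a b c0 : \sum_m christoffel (g s) m a b x * h s x c0 m =
    \sum_m christoffel (g s) m b a x * h s x c0 m.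
  by apply: eq_bigr => m _; rewrite (christoffelC openV gs m a b Vx).
by rewrite (C j i) (D i l j) (E' j l i); ring.
Qed.

Lemma ricci_is_derive s x : I s -> V x ->
  mx_is_derive s 1 (fun r => ricci (g r) x) (ricci_var (g s) (h s) x).
Proof.
move=> Is Vx j k; rewrite mxE; under eq_fun do rewrite mxE.
have dC l a b c0 : is_derive s 1 (fun r => partial l (christoffel (g r) a b c0) x)
    (partial l (christoffel_var (g s) (h s) a b c0) x).
  have [_ /(_ l)[_ _ d]] := christoffel_evolves a b c0 Is Vx; exact d.
have C a b c0 : is_derive s 1 (fun r => christoffel (g r) a b c0 x)
    (christoffel_var (g s) (h s) a b c0 x).
  by have [] := christoffel_evolves a b c0 Is Vx.
exact: (is_derive_bigsum _ _ (fun i => is_derive_add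
  (is_derive_sub (dC i i j k) (dC j i i k))
  (is_derive_bigsum _ _ (fun m => is_derive_sub
    (is_derive_mul (C i i m) (C m j k))
    (is_derive_mul (C i j m) (C m i k)))))).
Qed.

(** The derivative of the inverse metric contributes the pairing with Ricci, and the variation of
    Ricci contributes the double codifferential through [trace_ricci_var]. *)
Lemma scal_is_derive s x : I s -> V x ->
  is_derive s 1 (fun r => scal (g r) x)
    (delta1 (g s) (deltam (g s) (h s)) x
     - \tr (w s x *m h s x *m w s x *m ricci (g s) x)).
Proof.
move=> Is Vx.
have D := is_derive_trace
  (mx_is_derive_mul (inverse_mx_is_derive Is Vx) (ricci_is_derive Is Vx)).
apply: is_derive_eq D _.
rewrite mxtraceD mulNmx raddfN /= addrC; congr (_ - _).
apply: (trace_ricci_var openV) => //.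
- by move=> y; exact: gsym.
- by move=> y; exact: gunit.
- by move=> y *; exact: derivable_metric.
- by move=> y; exact: hsym.
- by move=> y *; exact: derivable_variation.
- move=> y l k i j Vy; have [_ /(_ l)[_ d _]] := christoffel_evolves k i j Is Vy.
  exact d.
Qed.

(** Jacobi's formula under a square root, with the adjugate written as determinant times inverse. *)
Lemma vol_is_derive s x : I s -> V x -> 0 < \det (g s x) ->
  is_derive s 1 (fun r => vol (g r) x)
    (2^-1 * trg (g s) (h s) x * vol (g s) x).
Proof.
move=> Is Vx det_gt0.
have D := is_derive_det (evolves_metric_mx Is Vx).
have S := is_derive1_sqrt det_gt0.
have T := is_derive1_comp S D.
apply: is_derive_eq T _; rewrite /vol /trg.
have -> : \adj (g s x) = \det (g s x) *: w s x.
  by rewrite /invmx gunit // scalerA mulfV ?scale1r // gt_eqF.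
rewrite -scalemxAl mxtraceZ.
have s0 : Num.sqrt (\det (g s x)) != 0 by rewrite gt_eqF // sqrtr_gt0.
rewrite -[X in _ * (X * _)](sqr_sqrtr (ltW det_gt0)).
by field.
Qed.

(** Everything is expressed by the endomorphism [P] = g^-1 h. In its derivative [Q] the square of
    [P] coming from g^-1 cancels the quadratic term of [Gammam], and the kinetic part changes at the
    rate tr (P Q) - tr P tr Q. *)
Lemma energy_is_derive (alpha lambda : R) s x : (2 <= n)%N -> I s -> V x ->
  mx_is_derive s 1 (fun r => h r x)
    (Gammam (g s) (h s) x - (2 * alpha) *: gradm_S lambda (g s) x) ->
  is_derive s 1 (fun r => energy alpha lambda (g r) (h r) x)
    (- 2^-1 * trg (g s) (h s) x * energy alpha lambda (g s) (h s) x
     + 2 * alpha * delta1 (g s) (deltam (g s) (h s)) x).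
Proof.
move=> n2 Is Vx dh.
pose P r := w r x *m h r x.
pose rho := ricci (g s) x.
have innermE r : innerm (g r) (h r) (h r) x = \tr (P r *m P r) - \tr (P r) * \tr (P r).
  by rewrite /innerm /trg /P !mulmxA.
have dP := mx_is_derive_mul (inverse_mx_is_derive Is Vx) dh.
set Q := (X in mx_is_derive _ _ _ X) in dP.
have dT := is_derive_trace dP.
have dI := is_derive_sub (is_derive_trace (mx_is_derive_mul dP dP)) (is_derive_mul dT dT).
have D := is_derive_add (is_derive_scale 2^-1 dI)
  (is_derive_scale (2 * alpha) (is_derive_sub (scal_is_derive Is Vx)
     (is_derive_const (lambda * (n%:R - 1)) s 1))).
have {}D := is_derive_eq D _.
have -> : (fun r => energy alpha lambda (g r) (h r) x) = fun r =>
   2^-1 * (\tr (P r *m P r) - \tr (P r) * \tr (P r)) +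
   2 * alpha * (scal (g r) x - lambda * (n%:R - 1)).
  by apply/funext => r; rewrite -innermE.
apply: D => {dI dT dP}.
(* [beta] collects all multiples of the metric in the evolution equation; in [Q] they become
   multiples of the identity. *)
pose beta := (4 * (n%:R - 1))^-1 * innerm (g s) (h s) (h s) x
  + 2 * alpha * ((2 * (n%:R - 1))^-1 * scal (g s) x + lambda / 2).
have QE : Q = (- 2^-1 * \tr (P s)) *: P s - beta%:M + (2 * alpha) *: (w s x *m rho).
  rewrite /Q /Gammam /gradm_S -/rho.
  have wg : w s x *m g s x = 1%:M by rewrite mulVmx ?gunit.
  rewrite !mulmxBr -!scalemxAr !mulmxDr mulmxN -!scalemxAr wg !mulmxA mulNmx.
  rewrite -[w s x *m h s x]/(P s) -[trg _ _ _]/(\tr (P s)).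
  apply/matrixP => a b; rewrite !mxE /beta.
  by case: (a == b); rewrite ?mulr1n ?mulr0n; ring.
have trQ : \tr Q = - 2^-1 * \tr (P s) * \tr (P s) - n%:R * beta + 2 * alpha * scal (g s) x.
  rewrite QE mxtraceD mxtraceB !mxtraceZ mxtrace_scalar.
  by rewrite (mulr_natl beta).
have trPQ : \tr (P s *m Q) = - 2^-1 * \tr (P s) * \tr (P s *m P s) - beta * \tr (P s)
    + 2 * alpha * \tr (P s *m w s x *m rho).
  rewrite QE !mulmxDr mulmxN -!scalemxAr mxtraceD mxtraceB !mxtraceZ.
  by rewrite mul_mx_scalar mxtraceZ !mulmxA.
have trQP : \tr (Q *m P s) = \tr (P s *m Q) by exact: mxtrace_mulC.
rewrite mxtraceD -/(P s) trQP trPQ trQ /energy /scal_lambda innermE.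
rewrite -[trg _ _ _]/(\tr (P s)) -/rho -/(P s) /beta innermE.
(* The [beta] terms add up to (n - 1) beta tr P, which clears the denominators of [beta]; the Ricci
   pairing in [trPQ] cancels the one from [scal_is_derive]. *)
have n1 : n%:R - 1 != 0 :> R by rewrite subr_eq0 pnatr_eq1 gtn_eqF.
by field.
Qed.

End LocalEvolution.

(** * Positive definite matrices *)

Lemma posdef_unitmx (R : realFieldType) (n : nat) (A : 'M[R]_n) :
  (forall v : 'rV_n, v != 0 -> 0 < (v *m A *m v^T) 0 0) -> A \in unitmx.
Proof.
(* A row of the kernel is annihilated by [A], so the quadratic form vanishes on it and the row is
   zero. *)
move=> Apos; rewrite -row_free_unit -kermx_eq0; apply/eqP/row_matrixP => i.
rewrite row0; apply/eqP/negPn/negP => /Apos.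
by rewrite -row_mul mulmx_ker row0 mul0mx mxE ltxx.
Qed.

(* The determinant does not vanish along the segment from the identity to [A],
   which consists of positive definite matrices. *)
Lemma posdef_det_gt0 (R : rcfType) (n : nat) (A : 'M[R]_n) :
  (forall v : 'rV_n, v != 0 -> 0 < (v *m A *m v^T) 0 0) -> 0 < \det A.
Proof.
move=> Apos.
(* The segment is encoded as a matrix of polynomials, so that its determinant is a polynomial and
   the intermediate value theorem for polynomials applies. *)
pose B : 'M[{poly R}]_n := map_mx polyC (1%:M) + 'X *: map_mx polyC (A - 1%:M).
have BE r : (\det B).[r] = \det (1%:M + r *: (A - 1%:M)).
  rewrite -[_.[r]]/(horner_eval r (\det B)) -det_map_mx; congr (\det _).
  apply/matrixP => i j; rewrite !mxE /= /horner_eval hornerD hornerM hornerX.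
  by rewrite !hornerC.
have det0 : (\det B).[0] = 1 by rewrite BE scale0r addr0 det1.
have det1 : (\det B).[1] = \det A by rewrite BE scale1r addrC subrK.
rewrite -det1 ltNge; apply/negP => le0.
have [||r /andP[r0 r1] /rootP] := @poly_ivt R (- \det B) 0 1.
- exact: ler01.
- by rewrite !hornerN det0 oppr_le0 ler01 oppr_ge0 le0.
rewrite hornerN => /eqP; rewrite oppr_eq0 BE; apply/negP.
rewrite -unitfE -unitmxE; apply: posdef_unitmx => v v0.
have vv : 0 < (v *m v^T) 0 0.
  rewrite mxE lt_neqAle eq_sym psumr_neq0.
    have [i vi] := rV0Pn _ v0.
    rewrite sumr_ge0 ?andbT; last by move=> j _; rewrite mxE -expr2 sqr_ge0.
    apply/hasP; exists i; first exact: mem_index_enum.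
    by rewrite mxE /= -expr2 exprn_even_gt0 ?orbT.
  by move=> j _; rewrite mxE -expr2 sqr_ge0.
(* The form on the segment is a convex combination of two positive numbers. *)
have -> : v *m (1%:M + r *: (A - 1%:M)) *m v^T =
    (1 - r) *: (v *m v^T) + r *: (v *m A *m v^T).
  rewrite mulmxDr -scalemxAr mulmxBr !mulmx1 mulmxDl -scalemxAl mulmxBl.
  by rewrite scalerBr scalerBl scale1r addrA addrAC.
rewrite mxE [X in X + _]mxE [X in _ + X]mxE.
have := Apos v v0; nra.
Qed.

(** * From curves in the Fréchet space to components in a chart *)

Lemma smooth_curve_evolves (R : realType) (n : nat) (M : manifold R n)
    (I : set R) (g : R -> tfield M) (c : chart M) (m : nat) (l : seq 'I_n)
    (i j : 'I_n) :
  open I -> smooth_curve I g ->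
  let u := iter m (@tderiv R n M) g in
  evolves I (chart_img c)
    (fun s => iter_partial l (fun x => u s c x i j))
    (fun s => iter_partial l (fun x => tderiv u s c x i j)).
Proof.
move=> openI hg u.
have smooth k s : I s ->
    smooth_on (chart_img c) (fun x => iter k (@tderiv R n M) g s c x i j).
  by move=> Is; have [[+ _ _] _] := hg k s Is; exact.
have time (l' : seq 'I_n) s x : I s -> chart_img c x ->
    is_derive s 1 (fun r => iter_partial l' (fun x => u r c x i j) x)
      (iter_partial l' (fun x => tderiv u s c x i j) x).
  move=> Is cx.
  have [_ cvg_u] := hg m s Is; rewrite -/u in cvg_u.
  have xV : [set x] `<=` chart_img c by move=> _ ->.
  (* Uniform convergence is used on the compact set consisting of one point, for every iterated
     partial derivative. *)
  have D := cvg_u c [set x] l' i j (@compact_set1 _ x) xV.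
  rewrite uniform_set1 in D.
  have {}D : (fun e : R => e^-1 *: (iter_partial l' (fun x => u (e *: 1 + s) c x i j) x
      - iter_partial l' (fun x => u s c x i j) x)) @ 0^' -->
      iter_partial l' (fun x => tderiv u s c x i j) x.
    apply: cvg_trans D; apply: near_eq_cvg.
    (* For small [e] the time [s + e] stays in [I], where the components are smooth, so
       [iter_partial] acts termwise on the difference quotient. *)
    have : \forall e \near (0 : R), I (s + e).
      have /nbhs_ballP[eps eps0 Ieps] := open_nbhs_nbhs (conj openI Is).
      exists eps => //= e; rewrite /= sub0r normrN => e_eps.
      by apply: Ieps; rewrite /ball /= opprD addNKr normrN.
    move=> nearI; near=> e.
    have Ie : I (s + e) by near: e; exact: nbhs_dnbhs nearI.
    have E := iter_partial_scaled_sub (@chart_img_open _ _ M c) l' e^-1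
      (smooth m _ Ie) (smooth m _ Is).
    rewrite [_ *: 1]mulr1 [e + s]addrC; apply: etrans (E x (mem_set cx)).
    congr (iter_partial _ _ x); apply/funext => y.
    by rewrite !mxE.
  apply: DeriveDef; first by apply/cvg_ex; eexists; exact: D.
  exact/cvg_lim/D.
move=> s x Is cx; split; first exact: time.
move=> a; split.
- by apply: diff_derivable; exact: (smooth m s Is l x cx).
- by apply: diff_derivable; exact: (smooth m.+1 s Is l x cx).
(* Commuting with one more spatial derivative is the same statement for a longer list of indices. *)
- exact: (time (a :: l)).
Unshelve. all: by end_near. Qed.

(** * Energy balance along a solution *)

Theorem theorem5p6 (R : realType) (n : nat) (hn : (2 <= n)%N)
  (M : manifold R n) (compactM : compact [set: M])
  (connectedM : connected [set: M])
  (alpha lambda : R) (halpha : alpha != 0)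
  (I : set R) (openI : open I) (intervalI : is_interval I)
  (g : R -> tfield M) (hg : smooth_metric_curve I g)
  (sol : evolution_eq alpha lambda I g)
  (t : R) (ht : I t) (c : chart M) (p : M) (hp : chart_dom c p) :
  let k := tderiv g in
  let x := chart_map c p in
  [/\ is_derive t 1 (fun s => energy alpha lambda (g s c) (k s c) x)
        (- 2^-1 * trg (g t c) (k t c) x * energy alpha lambda (g t c) (k t c) x
         + 2 * alpha * delta1 (g t c) (deltam (g t c) (k t c)) x),
      is_derive t 1 (fun s => vol (g s c) x)
        (2^-1 * trg (g t c) (k t c) x * vol (g t c) x) &
      is_derive t 1
        (fun s => energy alpha lambda (g s c) (k s c) x * vol (g s c) x)
        (2 * alpha * delta1 (g t c) (deltam (g t c) (k t c)) x
         * vol (g t c) x)].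
Proof.
have [curve metric] := hg.
move=> k x; have cx : chart_img c x by exact: map_in_img.
have openV := @chart_img_open _ _ M c.
have gsym s y : I s -> chart_img c y -> (g s c y)^T = g s c y.
  by move=> Is cy; have [[_ + _] _] := metric s Is; exact.
have ksym s y : I s -> chart_img c y -> (k s c y)^T = k s c y.
  by move=> Is cy; have [[_ + _] _] := curve 1%N s Is; exact.
have gpos s y : I s -> chart_img c y ->
    forall v : 'rV[R]_n, v != 0 -> 0 < (v *m g s c y *m v^T) 0 0.
  by move=> Is cy; have [_ +] := metric s Is; exact.
have gunit s y : I s -> chart_img c y -> g s c y \in unitmx.
  by move=> Is cy; apply: posdef_unitmx; exact: gpos.
have ev m l i j := @smooth_curve_evolves R n M I g c m l i j openI curve.
have evg i j := ev 0%N [::] i j.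
have evdg l i j := ev 0%N [:: l] i j.
(* The first time derivative of the curve, [m = 1], evolves by g'', which the evolution equation
   makes explicit. *)
have dk : mx_is_derive t 1 (fun s => k s c x)
    (Gammam (g t c) (k t c) x - (2 * alpha) *: gradm_S lambda (g t c) x).
  move=> i j; rewrite -(sol t c x ht cx).
  by have [] := ev 1%N [::] i j t x ht cx.
have dE := energy_is_derive openI openV gsym ksym gunit evg evdg hn ht cx dk.
have dV := vol_is_derive gunit evg ht cx (posdef_det_gt0 (gpos _ _ ht cx)).
split; [exact: dE|exact: dV|].
(* In the product rule the two terms with half the trace of [k] cancel. *)
apply: is_derive_eq (is_derive_mul dE dV) _.
by ring.
Qed.
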